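(* Let $S$ be a robustly Markov semigroup and let $T$ be a finite semigroup. Then $S \times T$ is a robustly Markov semigroup if and only if $S \times T$ is finitely generated.
   Context: A finite alphabet $A$ represents a generating set for a semigroup $S$ if there is a map $\phi : A \to S$ extending to a surjective homomorphism $A^+ \to S$; $\overline{w} = w\phi$ is the element represented by $w \in A^+$. A language $L$ over $A$ is $+$-prefix-closed if for all $u \in A^+$, $v \in A^+$, $uv \in L$ implies $u \in L$. A robust Markov language for $S$ over $A$ is a regular $+$-prefix-closed language $L \subseteq A^+$ (not containing the empty word) such that every element of $S$ is represented by exactly one word in $L$, and every $w \in L$ has minimal length among all words in $A^+$ representing $\overline{w}$. $S$ is robustly Markov if it admits a robust Markov language over some finite alphabet representing a generating set for $S$. *)

(* Defs.v *)
From HB Require Import structures.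
From mathcomp Require Import all_boot.

Set Implicit Arguments.
Unset Strict Implicit.
Unset Printing Implicit Defensive.

#[short(type="finSemigroupType")]
HB.structure Definition FinSemigroup := {T of Semigroup T & Finite T}.

Section Words.
Local Open Scope group_scope.
Variables (S : semigroupType) (A : finType) (phi : A -> S).

(* The homomorphic extension A^+ -> S of [phi]; [None] only on the empty     *)
(* word, since a semigroup need not have an identity.                         *)
Definition word_value (w : seq A) : option S :=
  if w is a :: w' then Some (foldl (fun s b => s * phi b) (phi a) w') else None.

Definition represents (w : seq A) (s : S) : Prop := word_value w = Some s.

Definition generates : Prop := forall s : S, exists w : seq A, represents w s.

Lemma represents_cat u v x y :
  represents u x -> represents v y -> represents (u ++ v) (x * y).
Proof.
case: u v => [|a u] [|b v] //= [<-] [<-].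
rewrite /represents /= foldl_cat /=; congr Some.
by elim/last_ind: v => [//|v c IHv]; rewrite -!cats1 !foldl_cat /= IHv mulgA.
Qed.

Lemma represents_letter a : represents [:: a] (phi a).
Proof. by []. Qed.
End Words.

Definition finitely_generated (S : semigroupType) : Prop :=
  exists (A : finType) (phi : A -> S), generates phi.

Record dfa (A : finType) := DFA {
  dfa_state : finType;
  dfa_init : dfa_state;
  dfa_final : pred dfa_state;
  dfa_step : dfa_state -> A -> dfa_state }.

Definition dfa_accepts (A : finType) (M : dfa A) : pred (seq A) :=
  fun w => dfa_final (foldl (@dfa_step A M) (dfa_init M) w).

(* Boolean languages lose no generality here: a regular language is decidable. *)
Definition regular (A : finType) (L : {pred seq A}) : Prop :=
  exists M : dfa A, L =i dfa_accepts M.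

Definition plus_prefix_closed (A : finType) (L : {pred seq A}) : Prop :=
  forall u v : seq A, u != [::] -> v != [::] -> u ++ v \in L -> u \in L.

Record robust_markov_language (S : semigroupType) (A : finType) (phi : A -> S)
    (L : {pred seq A}) : Prop := RobustMarkovLanguage {
  rml_regular : regular L;
  rml_nonempty_words : [::] \notin L;
  rml_prefix_closed : plus_prefix_closed L;
  rml_unique : forall s : S, exists! w : seq A, w \in L /\ represents phi w s;
  rml_minimal : forall (w u : seq A) (s : S),
    w \in L -> represents phi w s -> represents phi u s -> size w <= size u }.

Definition robustly_markov (S : semigroupType) : Prop :=
  exists (A : finType) (phi : A -> S) (L : {pred seq A}),
    generates phi /\ robust_markov_language phi L.

(* Main.v *)
(**
  Suppose [S * T] is finitely generated.  If some [t] in [T] is not a product,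
  every element of [S * {t}] has to be a generator, so [S] is finite and one-letter
  words form a robust Markov language.  Otherwise every [t] factors as
  [(d t).1 * (d t).2] for a fixed choice [d]; iterating the factorization on the
  left component gives every [t] a preferred word of each positive length.  These
  words are prefix-closed, and are recognized by an automaton which remembers the
  value [t] of the word read so far and checks that appending [c] is consistent
  with [d (t * c) = (t, c)].  Over the alphabet [A * T], pair each word of the
  language of [S] with the preferred words of the same length.
*)
Require Import Defs.
From mathcomp Require Import all_boot.

Set Implicit Arguments.
Unset Strict Implicit.
Unset Printing Implicit Defensive.

Section WordValues.
Local Open Scope group_scope.

Lemma word_value_rcons (S : semigroupType) (A : finType) (phi : A -> S) w a :
  word_value phi (rcons w a) =
  Some (if word_value phi w is Some x then x * phi a else phi a).
Proof. by case: w => [|b w] //=; rewrite foldl_rcons. Qed.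

Lemma word_value_map (S : semigroupType) (A B : finType) (h : B -> A)
    (phi : A -> S) w :
  word_value phi (map h w) = word_value (phi \o h) w.
Proof.
elim/last_ind: w => [//|w b IHw].
by rewrite map_rcons !word_value_rcons IHw.
Qed.

Lemma word_value_morph (S T : semigroupType) (f : S -> T) (A : finType)
    (phi : A -> S) w :
  {morph f : x y / x * y} -> word_value (f \o phi) w = omap f (word_value phi w).
Proof.
move=> fM; elim/last_ind: w => [//|w a IHw].
by rewrite !word_value_rcons IHw; case: (word_value phi w) => //= x; rewrite fM.
Qed.

Lemma represents_pair (S T : semigroupType) (A : finType)
    (phi : A -> (S * T)%type) w s t :
  represents phi w (s, t) <->
  represents (fst \o phi) w s /\ represents (snd \o phi) w t.
Proof.
rewrite /represents !word_value_morph //.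
case: (word_value phi w) => [[x y]|] /=; last by split=> // -[].
by split=> [[-> ->]|[[->] [->]]].
Qed.

End WordValues.

Section RegularLanguages.
Variable A : finType.

Lemma regular_preim_map (B : finType) (h : B -> A) (L : {pred seq A}) :
  regular L -> regular [pred w | map h w \in L].
Proof.
case=> M LM.
exists (@DFA B _ (dfa_init M) (@dfa_final A M) (fun q b => dfa_step q (h b))) => w.
rewrite inE LM /dfa_accepts /= !unfold_in.
by elim: w (dfa_init M) => //=.
Qed.

Lemma regularI (L K : {pred seq A}) :
  regular L -> regular K -> regular [predI L & K].
Proof.
case=> M LM [N KN].
exists (@DFA A _ (dfa_init M, dfa_init N)
  (fun q => dfa_final q.1 && dfa_final q.2)
  (fun q a => (dfa_step q.1 a, dfa_step q.2 a))) => w.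
rewrite inE LM KN /dfa_accepts /= !unfold_in.
by elim: w (dfa_init M) (dfa_init N) => //=.
Qed.

Lemma regular_letters (P : pred A) :
  regular [pred w : seq A | if w is [:: a] then P a else false].
Proof.
(* [None] means that nothing has been read; any second letter leads to the absorbing state
   [Some false]. *)
exists (@DFA A (option bool) None (pred1 (Some true))
  (fun q a => Some (if q is None then P a else false))) => w.
rewrite /dfa_accepts inE unfold_in /=.
case: w => [//|a [|b w]] /=; first by case: (P a).
by elim: w.
Qed.

End RegularLanguages.

Lemma robustly_markov_finite (S : semigroupType) (A : finType) (phi : A -> S) :
  (forall s, exists a, phi a = s) -> robustly_markov S.
Proof.
move=> phi_surj.
(* The outcome of [pick] depends only on [phi a], so exactly one letter above each element is
   canonical. *)
pose canon a := [pick b | phi b == phi a] == Some a.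
pose L : {pred seq A} := [pred w | if w is [:: a] then canon a else false].
exists A, phi, L.
split=> [s|]; first by have [a <-] := phi_surj s; exists [:: a].
split=> //; first exact: regular_letters.
- by move=> [|a [|b u]] [|c v].
- move=> s; have [a0 <-] := phi_surj s.
  case pick_a: [pick b | phi b == phi a0] => [a|]; last first.
    by move: pick_a; case: pickP => // /(_ a0); rewrite eqxx.
  have phi_a : phi a = phi a0.
    by move: pick_a; case: pickP => // b /eqP phi_b [<-].
  exists [:: a]; split=> [|[|b [|c w]] [] //].
    by rewrite inE /canon phi_a pick_a eqxx /represents /= phi_a.
  by rewrite inE /canon => /eqP + [phi_b]; rewrite phi_b pick_a => -[->].
- by move=> [|a [|b w]] [|c u].
Qed.

(** A word of two or more letters has a product as its second component, so only a single letter can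
    represent [(s, t)]. *)
Lemma irreducible_factor_finite (S T : semigroupType) (A : finType)
    (phi : A -> (S * T)%type) (t : T) :
  generates phi -> (forall x y : T, (x * y)%g <> t) ->
  forall s, exists a, (phi a).1 = s.
Proof.
move=> gen irr s; have [w] := gen (s, t).
case: (lastP w) => [//|{}w a]; rewrite /represents word_value_rcons.
case: (word_value phi w) => [x|] [/=]; last by move=> phi_a; exists a; rewrite phi_a.
by move=> _ /irr.
Qed.

Section PreferredWords.
Local Open Scope group_scope.
Variables (T : finSemigroupType) (d : T -> T * T).
Hypothesis dK : forall t, (d t).1 * (d t).2 = t.

Fixpoint preferred n t : seq T :=
  if n is n'.+1 then rcons (preferred n' (d t).1) (d t).2 else [:: t].

Lemma size_preferred n t : size (preferred n t) = n.+1.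
Proof. by elim: n t => //= n IHn t; rewrite size_rcons IHn. Qed.

(* [None] is the initial state and [Some None] the dead one. *)
Definition preferred_step (q : option (option T)) (c : T) : option (option T) :=
  match q with
  | None => Some (Some c)
  | Some None => Some None
  | Some (Some t) => Some (if d (t * c) == (t, c) then Some (t * c) else None)
  end.

Definition preferred_dfa : dfa T :=
  @DFA T _ None [pred q | if q is Some (Some _) then true else false] preferred_step.

Lemma preferred_run n t : foldl preferred_step None (preferred n t) = Some (Some t).
Proof.
elim: n t => //= n IHn t.
by rewrite foldl_rcons IHn /= dK -surjective_pairing eqxx.
Qed.

(** The check [d (t * c) = (t, c)] lets the final value determine the last letter and the value
    before it, so the word can be recovered from right to left. *)
Lemma preferred_runP w t :
  foldl preferred_step None w = Some (Some t) ->
  represents id w t /\ w = preferred (size w).-1 t.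
Proof.
elim/last_ind: w t => [//|w c IHw] t; rewrite foldl_rcons size_rcons /=.
case run_w: (foldl _ _ w) IHw => [[x|]|] IHw //=.
  case: eqP => // dxc [<-]; have [val_w def_w] := IHw x erefl.
  split; first by rewrite /represents word_value_rcons val_w.
  case: (w) val_w def_w => [//|a w'] _ /= def_w.
  by rewrite dxc /= -def_w.
(* No transition enters [None], so here [w] is empty and [c] is the first letter. *)
move=> [<-]; case: (lastP w) run_w => [//|w' b].
by rewrite foldl_rcons; case: (foldl _ _ w') => [[]|].
Qed.

Lemma accepted_preferred w t :
  w \in dfa_accepts preferred_dfa -> represents id w t ->
  w = preferred (size w).-1 t.
Proof.
rewrite unfold_in /=; case run_w: (foldl _ _ w) => [[x|]|] //= _.
have [val_w def_w] := preferred_runP run_w.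
by rewrite /represents val_w => -[<-].
Qed.

Lemma represents_preferred n t : represents id (preferred n t) t.
Proof. by have [] := preferred_runP (preferred_run n t). Qed.

Lemma accepts_preferred n t : preferred n t \in dfa_accepts preferred_dfa.
Proof. by rewrite unfold_in /= preferred_run. Qed.

(** The dead state is absorbing and the initial one is never reentered, so a nonempty prefix of an
    accepted word ends in a live state. *)
Lemma preferred_prefix_closed : plus_prefix_closed (dfa_accepts preferred_dfa).
Proof.
move=> u v u_neq0 _; rewrite !unfold_in /= foldl_cat.
have : foldl preferred_step None u <> None.
  case: (lastP u) u_neq0 => [//|u' b] _.
  by rewrite foldl_rcons; case: (foldl _ _ u') => [[]|].
by case: (foldl _ _ u) => [[]|] // _; elim: v.
Qed.

End PreferredWords.

Lemma robustly_markov_prod (S : semigroupType) (T : finSemigroupType)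
    (d : T -> T * T) :
  (forall t, ((d t).1 * (d t).2)%g = t) ->
  robustly_markov S -> robustly_markov (S * T)%type.
Proof.
move=> dK [A [phi [L [gen [regL L0 preL uniqL minL]]]]].
pose B : finType := (A * T)%type.
pose psi (b : B) : (S * T)%type := (phi b.1, b.2).
pose K := dfa_accepts (preferred_dfa d).
have psiP w s t : represents psi w (s, t) <->
    represents phi (map fst w) s /\ represents id (map snd w) t.
  by rewrite /represents !word_value_map; exact: represents_pair.
pose LK : {pred seq B} := [predI [pred w | map fst w \in L] & [pred w | map snd w \in K]].
have existLK s t : exists w, [/\ w \in LK & represents psi w (s, t)].
  have [w [[Lw ws] _]] := uniqL s.
  (* [preferred n] has [n.+1] letters; [w] is nonempty because it represents [s]. *)
  have w_size : size w = size (preferred d (size w).-1 t).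
    by rewrite size_preferred prednK //; case: (w) ws.
  exists (zip w (preferred d (size w).-1 t)).
  split; last apply/psiP;
    rewrite ?inE -/(unzip1 _) -/(unzip2 _) unzip1_zip ?unzip2_zip -?w_size //.
    by rewrite Lw accepts_preferred.
  by split=> //; exact: represents_preferred.
exists B, psi, LK; split=> [[s t]|]; first by have [w []] := existLK s t; exists w.
split.
- by apply: regularI; apply: regular_preim_map => //; exists (preferred_dfa d).
- by rewrite !inE (negPf L0).
- move=> u v u0 v0; rewrite !inE !map_cat => /andP[Luv Kuv].
  have map0 (C : eqType) (h : B -> C) w : w != [::] -> map h w != [::] by case: w.
  by rewrite (preL _ _ _ _ Luv) ?(preferred_prefix_closed _ _ Kuv) ?map0.
- move=> [s t]; have [w [LKw w_st]] := existLK s t.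
  exists w; split=> // u [LKu u_st].
  have [[w_s w_t] [u_s u_t]] := ((psiP _ _ _).1 w_st, (psiP _ _ _).1 u_st).
  move: LKw LKu; rewrite !inE => /andP[Lw Kw] /andP[Lu Ku].
  have [v [_ v_uniq]] := uniqL s.
  have fst_eq : map fst w = map fst u.
    by rewrite -(v_uniq _ (conj Lw w_s)) -(v_uniq _ (conj Lu u_s)).
  (* Equal first tracks force equal lengths, and length and value determine an accepted word over
     [T]. *)
  have snd_eq : map snd w = map snd u.
    rewrite (accepted_preferred Kw w_t) (accepted_preferred Ku u_t) !size_map.
    by rewrite -(size_map fst w) fst_eq size_map.
  by rewrite -(zip_unzip w) -(zip_unzip u) /unzip1 /unzip2 fst_eq snd_eq.
(* Projection to the first track preserves length, so minimality is inherited from [L]. *)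
- move=> w u [s t]; rewrite inE => /andP[Lw _] /psiP[w_s _] /psiP[u_s _].
  by rewrite -(size_map fst w) -(size_map fst u); apply: minL Lw w_s u_s.
Qed.

Theorem theorem14p3 (S : semigroupType) (T : finSemigroupType) :
  robustly_markov S ->
  (robustly_markov (S * T)%type <-> finitely_generated (S * T)%type).
Proof.
move=> rmS; split=> [[A [phi [_ [gen _]]]]|[A [phi gen]]]; first by exists A, phi.
have [/forallP prodT|] := boolP [forall t : T, exists p : T * T, (p.1 * p.2)%g == t].
  have [d dK] := fin_all_exists (fun t => existsP (prodT t)).
  by apply: (@robustly_markov_prod S T d _ rmS) => t; apply/eqP.
rewrite negb_forall => /existsP[t]; rewrite negb_exists => /forallP irr.
have surjS := irreducible_factor_finite gen (fun x y xy => negP (irr (x, y)) (introT eqP xy)).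
(* First components of generators exhaust [S]; pairing them with all of [T] makes every element of
   the product a letter value. *)
apply: (@robustly_markov_finite _ (A * T)%type (fun c => ((phi c.1).1, c.2))) => -[s u].
by have [a <-] := surjS s; exists (a, u).
Qed.
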